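(* Let $\mathcal{A}$ be a unital Banach $*$-algebra, let $\mathcal{M}$ be a unital $*$-$\mathcal{A}$-bimodule, and let $W\in\mathcal{A}$ be a left separating point of $\mathcal{M}$. Suppose that $WA=AW$ for all $A\in\mathcal{A}$. If $\delta:\mathcal{A}\to\mathcal{M}$ is a linear mapping satisfying $$A,B\in\mathcal{A},\ AB^*=W \quad\Longrightarrow\quad \delta(W)=A\delta(B)^*+B^*\delta(A),$$ then $\delta$ is a Jordan left derivation.
   Context: Algebras are over the real or complex field. A $*$-$\mathcal{A}$-bimodule over a $*$-algebra $\mathcal{A}$ is an $\mathcal{A}$-bimodule $\mathcal{M}$ with a conjugate-linear map $M\mapsto M^*$ satisfying $M^{**}=M$, $(AM)^*=M^*A^*$, $(MA)^*=A^*M^*$ for $A\in\mathcal{A}$, $M\in\mathcal{M}$; it is unital if $IM=MI=M$, where $I$ is the unit of $\mathcal{A}$. $\delta(B)^*$ means $(\delta(B))^*$. No continuity of $\delta$ is assumed. An element $W\in\mathcal{A}$ is a left separating point of $\mathcal{M}$ if $WM=0$ implies $M=0$ for each $M\in\mathcal{M}$. A linear mapping $\delta:\mathcal{A}\to\mathcal{M}$ is a Jordan left derivation if $\delta(A^2)=2A\delta(A)$ for each $A\in\mathcal{A}$. *)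

(* Defs.v *)
From HB Require Import structures.
From mathcomp Require Import all_boot all_order all_algebra.
From mathcomp Require Import all_classical all_reals all_analysis.
From mathcomp Require Import complex.

Set Implicit Arguments.
Unset Strict Implicit.
Unset Printing Implicit Defensive.

Import GRing.Theory.
Local Open Scope ring_scope.

Variant base_field := RealField | ComplexField.

Definition scalar_field (R : realType) (F : base_field) : numFieldType :=
  match F with
  | RealField => R
  | ComplexField => R[i]%C
  end.

(* Conjugation is trivial on real scalars, so that a conjugate-linear map over
   a real algebra is just a linear one. *)
Definition scalar_conj (R : realType) (F : base_field) :
    scalar_field R F -> scalar_field R F :=
  match F with
  | RealField => id
  | ComplexField => @conjc R
  end.

(* Hierarchy-Builder cannot declare a structure that inherits both from rings
   and from normed modules (the join with numDomainType is missing), so a unital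
   Banach algebra is a record adding a product to a completeNormedModType, and
   the algebra structure is declared on its carrier.  The unit is not required
   to have norm 1; it is required to be nonzero, as in every MathComp algebra
   (over the zero algebra every unital bimodule is zero). *)
Record banachAlgType (K : numFieldType) := BanachAlgebra {
  banach_space : completeNormedModType K;
  bmul : banach_space -> banach_space -> banach_space;
  bone : banach_space;
  bmulA : associative bmul;
  bmul1r : left_id bone bmul;
  bmulr1 : right_id bone bmul;
  bmulDl : left_distributive bmul +%R;
  bmulDr : right_distributive bmul +%R;
  bone_neq0 : bone != 0;
  bscaleAl : forall (k : K) a b, k *: bmul a b = bmul (k *: a) b;
  bscaleAr : forall (k : K) a b, k *: bmul a b = bmul a (k *: b);
  bnormM : forall a b, `|bmul a b| <= `|a| * `|b|
}.

Definition banach_sort (K : numFieldType) (A : banachAlgType K) : Type :=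
  banach_space A.
Coercion banach_sort : banachAlgType >-> Sortclass.

HB.instance Definition _ (K : numFieldType) (A : banachAlgType K) :=
  CompleteNormedModule.copy (banach_sort A) (banach_space A).
HB.instance Definition _ (K : numFieldType) (A : banachAlgType K) :=
  GRing.Zmodule_isNzRing.Build (banach_sort A)
    (@bmulA K A) (@bmul1r K A) (@bmulr1 K A) (@bmulDl K A) (@bmulDr K A)
    (@bone_neq0 K A).
HB.instance Definition _ (K : numFieldType) (A : banachAlgType K) :=
  GRing.Lmodule_isLalgebra.Build K (banach_sort A) (@bscaleAl K A).
HB.instance Definition _ (K : numFieldType) (A : banachAlgType K) :=
  GRing.Lalgebra_isAlgebra.Build K (banach_sort A) (@bscaleAr K A).

(* On a Banach algebra the involution is not required to be isometric or
   continuous. *)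
Record involution (R : realType) (F : base_field)
    (A : algType (scalar_field R F)) := Involution {
  star :> A -> A;
  starD : forall a b, star (a + b) = star a + star b;
  starZ : forall (k : scalar_field R F) a,
    star (k *: a) = scalar_conj k *: star a;
  starM : forall a b, star (a * b) = star b * star a;
  starK : forall a, star (star a) = a
}.

HB.mixin Record isUnitalBimodule (K : numFieldType) (A : algType K) M
    of GRing.Lmodule K M := {
  lact : A -> M -> M;
  ract : M -> A -> M;
  lactDl : forall a b m, lact (a + b) m = lact a m + lact b m;
  lactDr : forall a m n, lact a (m + n) = lact a m + lact a n;
  lactZl : forall (k : K) a m, lact (k *: a) m = k *: lact a m;
  lactZr : forall (k : K) a m, lact a (k *: m) = k *: lact a m;
  lactM : forall a b m, lact (a * b) m = lact a (lact b m);
  lact1 : forall m, lact 1 m = m;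
  ractDl : forall m n a, ract (m + n) a = ract m a + ract n a;
  ractDr : forall m a b, ract m (a + b) = ract m a + ract m b;
  ractZl : forall (k : K) m a, ract (k *: m) a = k *: ract m a;
  ractZr : forall (k : K) m a, ract m (k *: a) = k *: ract m a;
  ractM : forall m a b, ract m (a * b) = ract (ract m a) b;
  ract1 : forall m, ract m 1 = m;
  lract : forall a m b, ract (lact a m) b = lact a (ract m b)
}.

#[short(type="unitalBimodType")]
HB.structure Definition UnitalBimodule (K : numFieldType) (A : algType K) :=
  {M of GRing.Lmodule K M & isUnitalBimodule K A M}.

Record bimodule_involution (R : realType) (F : base_field)
    (A : algType (scalar_field R F)) (starA : involution A)
    (M : unitalBimodType A) := BimoduleInvolution {
  bstar :> M -> M;
  bstarD : forall m n, bstar (m + n) = bstar m + bstar n;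
  bstarZ : forall (k : scalar_field R F) m,
    bstar (k *: m) = scalar_conj k *: bstar m;
  bstarK : forall m, bstar (bstar m) = m;
  bstar_lact : forall (a : A) m, bstar (lact a m) = ract (bstar m) (starA a);
  bstar_ract : forall m (a : A), bstar (ract m a) = lact (starA a) (bstar m)
}.

Definition left_separating (K : numFieldType) (A : algType K)
    (M : unitalBimodType A) (w : A) : Prop :=
  forall m : M, lact w m = 0 -> m = 0.

Definition Jordan_left_derivation (K : numFieldType) (A : algType K)
    (M : unitalBimodType A) (delta : {linear A -> M}) : Prop :=
  forall a : A, delta (a ^+ 2) = 2 *: lact a (delta a).

(* Main.v *)
Require Import Defs.
From mathcomp Require Import all_boot all_order all_algebra.
From mathcomp Require Import all_classical all_reals all_analysis.
From mathcomp Require Import complex.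

(** Put tau b := delta (b^* )^*, an additive map.  The hypothesis becomes

      a b = W  ->  delta W = a tau(b) + b delta(a),

    a condition without involutions.  The pair (W, 1) gives W tau(1) = 0, hence
    tau 1 = 0 and delta 1 = 0.

    No continuity is available, so the condition is exploited through an exact
    algebraic identity instead of power series: if a and 1 - a are invertible,
    then a^-1 + (1 - a)^-1 = (a (1 - a))^-1.  Writing the condition for each of
    a, 1 - a and a (1 - a), paired with its inverse times W, and using that tau
    is additive on the two sides of this identity, all tau terms cancel.  As W is
    central, what is left can be written

      W (delta (a - a^2) - ((1 - a)^2 - a^2) delta a) = 0

    and, W being left separating, delta (a^2) = 2 a delta a
    (Jordan_left_at_inverse).

    The identity delta (a^2) = 2 a delta a is insensitive to scaling a and, as
    delta 1 = 0, to replacing a by 1 - a.  Hence it is enough to find, for each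
    t, an affine image a = 2 (1 - k t), k != 0, such that a and
    1 - a = - (1 - 2 k t) are invertible; for k small this is the Neumann series
    (neumann_inverse, exists_affine_inverse), and it is the only place where
    completeness enters. *)

Set Implicit Arguments.
Unset Strict Implicit.
Unset Printing Implicit Defensive.

Import Order.TTheory GRing.Theory Num.Theory.

Local Open Scope ring_scope.

(** * The Jordan identity at one element *)

Section LeftAction.
Variables (K : numFieldType) (A : algType K) (M : unitalBimodType A).
Implicit Types (a b : A) (m n : M) (k : K).

Lemma lactNl a m : lact (- a) m = - lact a m.
Proof. by rewrite -scaleN1r lactZl scaleN1r. Qed.

Lemma lactNr a m : lact a (- m) = - lact a m.
Proof. by rewrite -scaleN1r lactZr scaleN1r. Qed.

Lemma lactBl a b m : lact (a - b) m = lact a m - lact b m.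
Proof. by rewrite lactDl lactNl. Qed.

Lemma lactBr a m n : lact a (m - n) = lact a m - lact a n.
Proof. by rewrite lactDr lactNr. Qed.

Definition Jordan_left_at (delta : A -> M) a :=
  delta (a ^+ 2) = 2 *: lact a (delta a).

(** Both sides are quadratic in a, and passing from a to 1 - a changes each of
    them by - 2 delta a. *)
Lemma Jordan_left_at_onem (delta : {linear A -> M}) a :
  delta 1 = 0 -> Jordan_left_at delta (1 - a) -> Jordan_left_at delta a.
Proof.
move=> d1; rewrite /Jordan_left_at.
have -> : (1 - a) ^+ 2 = 1 - a - (a - a ^+ 2).
  by rewrite !expr2 mulrBl mul1r mulrBr mulr1.
rewrite !linearB /= d1 sub0r lactNr lactBl lact1.
rewrite opprK addrA -opprD -mulr2n -scaler_nat opprB scalerBr addrC.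
by move/addIr.
Qed.

Lemma Jordan_left_at_scale (delta : {linear A -> M}) k a :
  k != 0 -> Jordan_left_at delta (k *: a) -> Jordan_left_at delta a.
Proof.
move=> k0; rewrite /Jordan_left_at exprZn !linearZ /= lactZr lactZl.
have k2 : k ^+ 2 != 0 by rewrite expf_neq0.
move=> E; apply: (scalerI k2).
by rewrite E !scalerA -expr2 mulrC.
Qed.

(** Here c is the inverse of a (1 - a), so that (1 - a) c and a c are the
    inverses of a and 1 - a, and their sum is c.  The tau terms of the equations
    e1, e2, e3 for the three invertible elements match because of this sum. *)
Lemma Jordan_left_at_inverse (W : A) (delta tau : A -> M)
    (deltaB : {morph delta : a b / a - b}) (tauD : {morph tau : a b / a + b})
    (W_sep : left_separating M W) (W_central : forall a, W * a = a * W)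
    (delta1 : delta 1 = 0)
    (deltaW : forall a b, a * b = W ->
       delta W = lact a (tau b) + lact b (delta a))
    a c :
  a * (1 - a) * c = 1 -> c * (a * (1 - a)) = 1 -> Jordan_left_at delta a.
Proof.
(* b is kept opaque: otherwise rewriting would see through it to 1 - a. *)
have [b bE] : {b | b = 1 - a} by exists (1 - a).
rewrite -bE => abc cab.
have ab : a * b = b * a by rewrite bE mulrBr mulrBl mulr1 mul1r.
have ac : a * c = c * a.
  rewrite -[LHS]mul1r -cab -!mulrA [b * (a * c)]mulrA -ab -!mulrA.
  by rewrite (mulrA a b c) abc mulr1.
have bc : b * c = c * b by rewrite bE mulrBl mulrBr mul1r mulr1 ac.
have e1 : delta W = lact a (tau (b * c * W)) + lact (b * c * W) (delta a).
  by apply: deltaW; rewrite !mulrA abc mul1r.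
have e2 : delta W = lact b (tau (a * c * W)) - lact (a * c * W) (delta a).
  rewrite -lactNr -[- delta a]sub0r -delta1 -deltaB -bE.
  by apply: deltaW; rewrite !mulrA -ab abc mul1r.
have e3 : delta W = lact (a * b) (tau (c * W)) + lact (c * W) (delta (a * b)).
  by apply: deltaW; rewrite mulrA abc mul1r.
have tc : tau (c * W) = tau (b * c * W) + tau (a * c * W).
  by rewrite -tauD -!mulrDl bE subrK mul1r.
have [n nE] : {n | n = b * b - a * a} by exists (b * b - a * a).
have nc : n * c = c * n.
  by rewrite nE mulrBl mulrBr -!mulrA bc ac !mulrA bc ac.
(* e comes from b e1 + a e2, whose left side is (b + a) delta W = delta W,
   compared with e3. *)
have e : lact (c * W) (delta (a * b)) = lact (n * (c * W)) (delta a).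
  apply: (addrI (lact (a * b) (tau (c * W)))); rewrite -e3.
  rewrite -[LHS]lact1 -[X in lact X _](subrK a) -bE lactDl {1}e1 e2.
  rewrite lactDr lactBr -!lactM -ab addrACA.
  by rewrite -lactDr -tc nE mulrBl lactBl !mulrA.
have Wn : lact W (delta (a * b) - lact n (delta a)) = 0.
  move/(congr1 (lact (a * b))): e; rewrite -!lactM !mulrA abc mul1r.
  rewrite -(mulrA _ n c) nc !mulrA abc mul1r -W_central lactM.
  by rewrite lactBr => ->; rewrite subrr.
have {}nE : n = 1 - a - a.
  by rewrite nE [X in X * b]bE mulrBl mul1r -addrA -opprD -mulrDr bE subrK mulr1.
have d_ab : delta (a * b) = delta a - delta (a ^+ 2).
  by rewrite bE mulrBr mulr1 deltaB.
rewrite /Jordan_left_at.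
move: (W_sep _ Wn); rewrite nE d_ab !lactBl lact1.
move/eqP; rewrite subr_eq0 -addrA -opprD => /eqP/addrI/oppr_inj ->.
by rewrite scaler_nat mulr2n.
Qed.
End LeftAction.

(** * Neumann series *)

(** Treats real and complex scalars at once: the order of R[i] is partial, and
    geometric convergence over it only needs that norms are bounded by
    integers. *)
Lemma archimedean_scalar_field (R : realType) (F : base_field) :
  Num.archimedean_axiom (scalar_field R F).
Proof.
case: F => x /=.
  by exists (Num.bound (`|x| : R)); exact: (archi_boundP (normr_ge0 (x : R))).
rewrite normc_def.
set r : R := Num.sqrt _; exists (Num.bound r).
have := archi_boundP (sqrtr_ge0 _ : 0 <= r); by rewrite -ltcR rmorph_nat.
Qed.

Section Neumann.
Variables (K : numFieldType) (archiK : Num.archimedean_axiom K).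

Lemma exprV2_lt_eps (C e : K) : 0 <= C -> 0 < e ->
  exists N, forall n, (N <= n)%N -> C * 2^-1 ^+ n < e.
Proof.
move=> C0 e0; have [N] := archiK (C / e).
rewrite ger0_norm ?divr_ge0 ?(ltW e0) // => CN; exists N => n Nn.
rewrite exprVn ltr_pdivrMr ?exprn_gt0 // mulrC -ltr_pdivrMr //.
apply: lt_le_trans CN _; rewrite -natrX ler_nat (leq_trans Nn) //.
exact/ltnW/ltn_expl.
Qed.

Lemma normr_le_eps_eq0 (V : normedModType K) (v : V) :
  (forall e : K, 0 < e -> `|v| <= e) -> v = 0.
Proof.
move=> ve; apply/eqP/negP => /negP; rewrite -normr_gt0 => v0.
have := ve (`|v| / 2); rewrite divr_gt0 // => /(_ isT).
by rewrite ler_pdivlMr // mulr_natr mulr2n gerDl lt_geF.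
Qed.

Variables (A : banachAlgType K) (x : A).
Hypothesis x_half : `|x| <= 2^-1.

Lemma banach_normM (y z : A) : `|y * z| <= `|y| * `|z|.
Proof. exact: bnormM. Qed.

Let S n : A := \sum_(i < n) x ^+ i.

Let S_recl n : S n.+1 = 1 + x * S n.
Proof.
rewrite /S big_ord_recl expr0 mulr_sumr; congr (_ + _).
by apply: eq_bigr => i _; rewrite -exprS.
Qed.

Let S_addn n m : S (n + m) = S n + x ^+ n * S m.
Proof.
elim: n => [|n IH]; first by rewrite /S big_ord0 add0r expr0 mul1r.
by rewrite addSn !S_recl IH mulrDr exprS !mulrA addrA.
Qed.

(* The factor `|1| covers n = 0: the unit may have norm larger than 1. *)
Let norm_exp n : `|x ^+ n| <= `|1 : A| * 2^-1 ^+ n.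
Proof.
elim: n => [|n IH]; first by rewrite !expr0 mulr1.
rewrite !exprS mulrCA (le_trans (banach_normM _ _)) //.
exact: ler_pM.
Qed.

Let norm_S n : `|S n| <= `|1 : A| * 2.
Proof.
elim: n => [|n IH]; first by rewrite /S big_ord0 normr0 mulr_ge0.
rewrite S_recl (le_trans (ler_normD _ _)) // mulr_natr mulr2n lerD2l.
rewrite (le_trans (banach_normM _ _)) //.
have two0 : 2 != 0 :> K by rewrite pnatr_eq0.
by rewrite -[leRHS](mulKf two0) ler_pM // [leRHS]mulrC.
Qed.

Let norm_subS n m : `|S (n + m) - S n| <= `|1 : A| * (`|1 : A| * 2) * 2^-1 ^+ n.
Proof.
rewrite S_addn addrAC subrr add0r (le_trans (banach_normM _ _)) //.
by rewrite mulrAC ler_pM.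
Qed.

Let cvg_S : (cvg (S n @[n --> \oo]))%classic.
Proof.
apply: cauchy_cvg; apply: cauchy_exP => e e0.
have [||N HN] := @exprV2_lt_eps (`|1 : A| * (`|1 : A| * 2)) e => //.
exists (S N); exists N => // n /= Nn.
rewrite -ball_normE /= distrC -(subnKC Nn).
exact: le_lt_trans (norm_subS _ _) (HN _ _).
Qed.

(** The inverse is the limit y of the sums S n of the x ^+ i for i < n: each of
    (1 - x) y - 1 and y (1 - x) - 1 differs from a multiple of y - S n by
    x ^+ n, and both quantities are arbitrarily small. *)
Lemma neumann_inverse : exists y, (1 - x) * y = 1 /\ y * (1 - x) = 1.
Proof.
set y : A := (lim (S n @[n --> \oo]))%classic.
have cvg_y : (S n @[n --> \oo] --> y)%classic by exact: cvg_S.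
have small e : 0 < e -> exists n, `|1 - x| * `|y - S n| + `|x ^+ n| <= e.
  move=> e0.
  have e1 : 0 < e / 2 / (`|1 - x| + 1) by rewrite !divr_gt0 // ltr_wpDl.
  have [N1 _ H1] := cvgr_dist_lt _ _ cvg_y _ e1.
  have [||N2 H2] := @exprV2_lt_eps (`|1 : A|) (e / 2) => //.
    by rewrite divr_gt0.
  exists (maxn N1 N2); rewrite (splitr e) lerD //; last first.
    by rewrite (le_trans (norm_exp _)) // ltW // H2 // leq_maxr.
  have := ltW (H1 _ (leq_maxl N1 N2)).
  rewrite ler_pdivlMr ?ltr_wpDl // mulrDr mulr1 mulrC.
  by apply: le_trans; rewrite lerDl.
have S1 n : (1 - x) * S n = 1 - x ^+ n.
  by rewrite -opprB mulNr -subrX1 opprB.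
have S2 n : S n * (1 - x) = 1 - x ^+ n.
  rewrite -S1; apply: GRing.commr_sym; apply: GRing.commr_sum => i _ /=.
  by apply: commrX; apply/commr_sym/commrB; [exact: commr1|exact: commr_refl].
exists y; split; apply/eqP; rewrite -subr_eq0; apply/eqP;
    apply: normr_le_eps_eq0 => e /small[n]; apply: le_trans.
  have -> : (1 - x) * y - 1 = (1 - x) * (y - S n) - x ^+ n.
    by rewrite mulrBr S1 opprB [x ^+ n - 1]addrC addrA addrK.
  by rewrite (le_trans (ler_normB _ _)) // lerD2r banach_normM.
have -> : y * (1 - x) - 1 = (y - S n) * (1 - x) - x ^+ n.
  by rewrite mulrBl S2 opprB [x ^+ n - 1]addrC addrA addrK.
by rewrite (le_trans (ler_normB _ _)) // lerD2r mulrC banach_normM.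
Qed.

End Neumann.

(** * Affine images with invertible a (1 - a) *)

(** With N > |t|, the choice k = 1/(4N) makes both k t and 2 k t of norm at most
    1/2. *)
Lemma exists_affine_inverse (K : numFieldType)
    (archiK : Num.archimedean_axiom K) (A : banachAlgType K) (t : A) :
  exists k : K, k != 0 /\ exists c : A,
    let a := 2 *: (1 - k *: t) in
    a * (1 - a) * c = 1 /\ c * (a * (1 - a)) = 1.
Proof.
have [N tN] := archiK `|t|; rewrite normr_id in tN.
have N0 : 0 < N%:R :> K by exact: le_lt_trans tN.
pose k : K := 4^-1 / N%:R.
have k0 : 0 < k by rewrite divr_gt0 ?invr_gt0.
set x : A := k *: t.
have x2 : `|2 *: x| <= 2^-1.
  rewrite /x scalerA normrZ gtr0_norm; last exact: mulr_gt0.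
  rewrite /k.
  have -> : 2 * (4^-1 / N%:R) = 2^-1 / N%:R :> K.
    rewrite mulrA; congr (_ / _).
    by rewrite (natrM K 2 2) invfM mulrA divff ?mul1r.
  by rewrite mulrAC ler_pdivrMr // ler_wpM2l // ltW.
have x1 : `|x| <= 2^-1.
  by apply: le_trans x2; rewrite [leRHS]normrZ gtr0_norm // ler_peMl // ler1n.
have [y [xy yx]] := neumann_inverse archiK x1.
have [z [xz zx]] := neumann_inverse archiK x2.
exists k; split; first by rewrite gt_eqF.
exists (- (2^-1 *: (z * y))); rewrite /= -/x.
have -> : 1 - 2 *: (1 - x) = - (1 - 2 *: x).
  rewrite scalerBr opprB [RHS]opprB addrCA; congr (_ + _).
  by rewrite scaler_nat mulr2n opprD addrA subrr sub0r.
move: (1 - x) (1 - 2 *: x) xy yx xz zx => u v uy yu vz zv.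
rewrite !(mulrN, mulNr, opprK) -!scalerAl -!scalerAr !scalerA.
rewrite mulfV ?mulVf ?pnatr_eq0 // !scale1r; split.
  by rewrite mulrA -(mulrA u v) vz mulr1.
by rewrite mulrA -(mulrA z y) yu mulr1.
Qed.

Theorem theorem3p6 (R : realType) (F : base_field)
    (A : banachAlgType (scalar_field R F)) (starA : involution A)
    (M : unitalBimodType A) (starM : bimodule_involution starA M)
    (W : A) (W_sep : left_separating M W)
    (W_central : forall a : A, W * a = a * W)
    (delta : {linear A -> M})
    (delta_W : forall a b : A, a * starA b = W ->
       delta W = lact a (starM (delta b)) + lact (starA b) (delta a)) :
  Jordan_left_derivation delta.
Proof.
have starA1 : starA 1 = 1.
  by rewrite -[LHS]mul1r -[X in X * _](starK starA) -Defs.starM mul1r starK.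
have starM0 : starM 0 = 0.
  by apply: (addrI (starM 0)); rewrite -bstarD !addr0.
pose tau b := starM (delta (starA b)).
have deltaW a b : a * b = W -> delta W = lact a (tau b) + lact b (delta a).
  by move=> ab; rewrite -[b in RHS](starK starA) /tau starK; apply: delta_W;
    rewrite starK.
have tauD : {morph tau : a b / a + b}.
  by move=> a b; rewrite /tau starD linearD bstarD.
have delta1 : delta 1 = 0.
  have : lact W (tau 1) = 0.
    apply: (addIr (delta W)); rewrite add0r -{1}[delta W]lact1.
    exact/esym/deltaW/mulr1.
  move/W_sep.
  by rewrite /tau starA1 => /(congr1 starM); rewrite bstarK starM0.
move=> t.
have [k [k0 [c [ac ca]]]] :=
  exists_affine_inverse (@archimedean_scalar_field R F) t.
(* Reduction from t to k t, then to 1 - k t, then to 2 (1 - k t). *)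
apply: (Jordan_left_at_scale k0); apply: (Jordan_left_at_onem delta1).
apply: (@Jordan_left_at_scale _ _ _ _ 2); first by rewrite pnatr_eq0.
exact: (Jordan_left_at_inverse (linearB delta) tauD W_sep W_central delta1
  deltaW ac ca).
Qed.
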